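(* Let $A_0,A_1,A_2\in\mathbb R^2$ be points of the plane, and let $\mathcal U_0\subset\mathbb R^2$ and $\mathcal U_1\subset\mathbb R^2$ be compact sets such that at least one of the following three conditions holds: (a) $\mathcal U_1=\chi_{P,\lambda}(\mathcal U_0)$ for some $P\in\mathbb R^2$ and some real number $\lambda>0$; (b) $\mathcal U_1$ is obtained from $\mathcal U_0$ by a translation; (c) at least one of $\mathcal U_0$ and $\mathcal U_1$ is a singleton. If $\mathcal U_0\cup\mathcal U_1\subseteq \mathrm{Conv}(\{A_0,A_1,A_2\})$, then there exist $j\in\{0,1,2\}$ and $k\in\{0,1\}$ such that $$\mathcal U_{1-k}\subseteq \mathrm{Conv}\bigl(\mathcal U_k\cup(\{A_0,A_1,A_2\}\setminus\{A_j\})\bigr).$$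
   Context: $\mathrm{Conv}$ denotes the usual convex hull operator in the plane $\mathbb R^2$. For $P\in\mathbb R^2$ and a real number $\lambda>0$, the positive homothety with center $P$ and ratio $\lambda$ is the map $\chi_{P,\lambda}\colon\mathbb R^2\to\mathbb R^2$, $X\mapsto(1-\lambda)P+\lambda X$. A translation is a map $\mathbb R^2\to\mathbb R^2$ of the form $X\mapsto Q+X$ with a fixed $Q\in\mathbb R^2$. *)

(* Defs.v *)
From HB Require Import structures.
From mathcomp Require Import all_boot all_order all_algebra.
From mathcomp Require Import all_classical all_reals all_analysis.

Set Implicit Arguments.
Unset Strict Implicit.
Unset Printing Implicit Defensive.

Import Order.TTheory GRing.Theory Num.Theory.
Import numFieldNormedType.Exports.

Local Open Scope classical_set_scope.
Local Open Scope ring_scope.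

Definition convex_hull (R : numDomainType) (M : lmodType R) (S : set M) :
  set M := smallest (@convex_set R M) S.

Definition homothety (R : pzRingType) (M : lmodType R) (P : M) (lambda : R)
  (X : M) : M := (1 - lambda) *: P + lambda *: X.

Definition translation (M : zmodType) (Q : M) (X : M) : M := Q + X.

(* Main.v *)
Require Import Defs.
From HB Require Import structures.
From mathcomp Require Import all_boot all_order all_algebra.
From mathcomp Require Import all_classical all_reals all_analysis.
From mathcomp Require Import ring lra.

Set Implicit Arguments.
Unset Strict Implicit.
Unset Printing Implicit Defensive.

Import Order.TTheory GRing.Theory Num.Theory.
Import numFieldNormedType.Exports.

Local Open Scope classical_set_scope.
Local Open Scope ring_scope.

(** The proof is by duality. For a linear form [f] and a set [S], write
    [h_S(f)] for the supremum of [f] on [S]. Suppose that no choice of [j] and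
    [k] works. Since a point outside the convex hull of a compact set can be
    strictly separated from it ([compact_separation]), there are, for each [j],
    two linear forms [f_j] and [g_j], both attaining their maximum over the
    triangle only at [A_j] ([not_covered_peak]), such that
    [phi(f_j) > 0 > phi(g_j)], where [phi(f) = h_{U_1}(f) - h_{U_0}(f)].

    Each of the three conditions makes [phi] concave or convex. For a homothety
    of ratio [lambda], [phi(f) = (1 - lambda)(f(P) - h_{U_0}(f))], which is
    concave for [lambda <= 1] and convex for [lambda >= 1]; for a translation
    by [Q], [phi(f) = f(Q)]; if [U_1 = {X}], [phi(f) = f(X) - h_{U_0}(f)] is
    concave, and if [U_0] is a singleton, [phi] is convex. Exchanging [U_0] and
    [U_1] reduces the convex case to the concave one.

    If [phi] is concave, it is positive on the convex cone generated by
    [f_0], [f_1] and [f_2]. This cone meets the interiors of the three normal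
    cones of the triangle. Either it contains the zero form, or it lies in an
    open half-plane; in the latter case it contains the whole of the middle one
    of the three normal cones, hence one of the [g_j]. Both are absurd. This is
    [dual_peaks], where the order of directions around the origin is expressed
    by signs of determinants. It allows collinear vertices; coinciding ones are
    ruled out first. *)

(** * Convex hulls *)

Lemma sub_convex_hull (R : numDomainType) (M : lmodType R) (S : set M) :
  S `<=` convex_hull S.
Proof. exact: sub_gen_smallest. Qed.

Lemma convex_hull_conv (R : realType) (M : lmodType R) (S : set M) (x y : M)
    (t : R) :
  0 <= t <= 1 -> convex_hull S x -> convex_hull S y ->
  convex_hull S (t *: x + (1 - t) *: y).
Proof.
move=> /andP[t0 t1] Sx Sy B [cB SB].
have := cB x y (Itv01 t0 t1).
by rewrite !inE; apply; [exact: Sx|exact: Sy].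
Qed.

(** The weights [a] and [b] need not be normalized, and may both vanish. *)
Lemma convex_hull_barycenter (R : realType) (M : lmodType R) (S : set M)
    (x y : M) (a b : R) :
  0 <= a -> 0 <= b -> convex_hull S x -> convex_hull S y ->
  exists2 z, convex_hull S z & (a + b) *: z = a *: x + b *: y.
Proof.
move=> a0 b0 Sx Sy.
have [ab0|ab0] := eqVneq (a + b) 0.
  have [-> ->] : a = 0 /\ b = 0 by split; lra.
  by exists x => //; rewrite addr0 !scale0r addr0.
have abgt0 : 0 < a + b by rewrite lt_neqAle eq_sym ab0 addr_ge0.
exists (a / (a + b) *: x + (1 - a / (a + b)) *: y).
  apply: convex_hull_conv => //.
  rewrite divr_ge0 ?(ltW abgt0)//=.
  by rewrite ler_pdivrMr// mul1r lerDl.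
rewrite scalerDr !scalerA; congr (_ *: _ + _ *: _); field; exact: ab0.
Qed.

(** A nontrivial nonnegative relation between the vectors joining three points
    of [S] to [v] puts [v] in the convex hull of [S]. *)
Lemma convex_hull_relation (R : realType) (M : lmodType R) (S : set M)
    (v x y z : M) (a b c : R) :
  S x -> S y -> S z -> 0 <= a -> 0 <= b -> 0 <= c -> 0 < a + b + c ->
  a *: (v - x) + b *: (v - y) + c *: (v - z) = 0 -> convex_hull S v.
Proof.
move=> /sub_convex_hull Sx /sub_convex_hull Sy /sub_convex_hull Sz a0 b0 c0 s0.
have [w Sw wE] := convex_hull_barycenter a0 b0 Sx Sy.
have [u Su uE] := convex_hull_barycenter (addr_ge0 a0 b0) c0 Sw Sz.
rewrite !scalerBr [X in X + _]addrACA -scalerDl -opprD.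
rewrite addrACA -scalerDl -opprD => rel.
suff -> : v = u by [].
by apply: (scalerI (lt0r_neq0 s0)); rewrite uE wE; apply: subr0_eq.
Qed.

Lemma convex_hull_ind (R : realType) (M : lmodType R) (S P : set M) :
  (forall x, S x -> P x) ->
  (forall x y t, 0 <= t -> t <= 1 -> P x -> P y ->
     P (t *: x + (1 - t) *: y)) ->
  convex_hull S `<=` P.
Proof.
move=> SP cP; apply: smallest_sub => // x y t; rewrite !inE => Px Py.
by apply: cP.
Qed.

(** * The scalar product of the plane and strict separation *)

Section Plane.
Variable R : realType.
Implicit Types f g u v w : 'rV[R]_2.

(** Linear forms on the plane are represented by vectors [f], acting by
    [dot f]. *)
Definition dot u v : R := u 0 0 * v 0 0 + u 0 1 * v 0 1.

Lemma dotC u v : dot u v = dot v u.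
Proof. by rewrite /dot mulrC [u 0 1 * _]mulrC. Qed.

Lemma dotDr f u v : dot f (u + v) = dot f u + dot f v.
Proof. by rewrite /dot !mxE; ring. Qed.

Lemma dotZr a f u : dot f (a *: u) = a * dot f u.
Proof. by rewrite /dot !mxE; ring. Qed.

Lemma dotBr f u v : dot f (u - v) = dot f u - dot f v.
Proof. by rewrite /dot !mxE; ring. Qed.

Lemma dotDl f u v : dot (u + v) f = dot u f + dot v f.
Proof. by rewrite /dot !mxE; ring. Qed.

Lemma dotZl a f u : dot (a *: u) f = a * dot u f.
Proof. by rewrite /dot !mxE; ring. Qed.

Lemma convex_hull_dot_lt (S : set 'rV[R]_2) f (c : R) :
  (forall s, S s -> dot f s < c) ->
  forall x, convex_hull S x -> dot f x < c.
Proof.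
move=> Sc; apply: (@convex_hull_ind R _ S (fun x => dot f x < c)) => //.
move=> x y t t0 t1 xc yc.
rewrite dotDr !dotZr; have [->|t_neq0] := eqVneq t 0; first by lra.
have : 0 < t * (c - dot f x).
  by rewrite mulr_gt0 ?subr_gt0// lt_neqAle eq_sym t_neq0.
have : 0 <= (1 - t) * (c - dot f y) by rewrite mulr_ge0 ?subr_ge0// ltW.
lra.
Qed.

Lemma convex_hull_dot_eq (S : set 'rV[R]_2) f (c : R) :
  (forall s, S s -> dot f s = c) ->
  forall x, convex_hull S x -> dot f x = c.
Proof.
move=> Sc; apply: (@convex_hull_ind R _ S (fun x => dot f x = c)) => //.
move=> x y t t0 t1 xc yc.
by rewrite dotDr !dotZr xc yc; ring.
Qed.

Lemma row2P u v : u 0 0 = v 0 0 -> u 0 1 = v 0 1 -> u = v.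
Proof.
move=> e0 e1; apply/rowP => -[[|[|//]] i].
- by rewrite (_ : Ordinal i = 0)//; exact/val_inj.
- by rewrite (_ : Ordinal i = 1)//; exact/val_inj.
Qed.

Lemma dot_ge0 u : 0 <= dot u u.
Proof. by rewrite /dot addr_ge0// -expr2 sqr_ge0. Qed.

Lemma dot_eq0 u : dot u u = 0 -> u = 0.
Proof.
rewrite /dot => /eqP; rewrite -!expr2 paddr_eq0 ?sqr_ge0// !sqrf_eq0.
by move=> /andP[/eqP u0 /eqP u1]; apply: row2P; rewrite mxE.
Qed.

(** The Gram determinant of three vectors of the plane vanishes. *)
Lemma dot_gram u p q : dot p p = 1 -> dot q q = 1 -> dot u u = 1 ->
  (dot u p - dot p q * dot u q) ^+ 2 = (1 - dot u q ^+ 2) * (1 - dot p q ^+ 2).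
Proof.
move=> pp qq uu.
have : (dot u u * dot q q - dot u q ^+ 2) * (dot p p * dot q q - dot p q ^+ 2)
       = (dot u p * dot q q - dot p q * dot u q) ^+ 2 by rewrite /dot; ring.
by rewrite pp qq uu !mulr1.
Qed.

Lemma dot_decomposition u p q : dot p p = 1 -> dot q q = 1 ->
  (1 - dot p q ^+ 2) *: u =
  (dot u p - dot p q * dot u q) *: p + (dot u q - dot p q * dot u p) *: q.
Proof.
move=> pp qq.
have -> : 1 - dot p q ^+ 2 = dot p p * dot q q - dot p q ^+ 2.
  by rewrite pp qq mulr1.
have -> : dot u p - dot p q * dot u q = dot u p * dot q q - dot p q * dot u q.
  by rewrite qq mulr1.
have -> : dot u q - dot p q * dot u p = dot u q * dot p p - dot p q * dot u p.
  by rewrite pp mulr1.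
by apply: row2P; rewrite /dot !mxE; ring.
Qed.

(** Let the angle of the unit vectors [p] and [q] be at least 90 and less than
    180 degrees. If [u] makes with [p + q] an angle of at least 90 degrees,
    while its angle with [q] does not exceed that of [p] with [q], its first
    coefficient in [dot_decomposition] is nonpositive. *)
Lemma unit_coef_le0 u p q :
  dot p p = 1 -> dot q q = 1 -> dot u u = 1 ->
  -1 < dot p q -> dot p q <= 0 -> dot p q <= dot u q ->
  dot u p + dot u q <= 0 -> dot u p <= dot p q * dot u q.
Proof.
move=> pp qq uu; have := dot_gram pp qq uu.
set c := dot p q; set l := dot u p; set m := dot u q => gram c1 c0 cm lm0.
rewrite leNgt; apply/negP => lcm.
have m0 : m < 0 by nra.
have cc : 0 < 1 - c ^+ 2 by nra.
have mc : m ^+ 2 <= c ^+ 2 by nra.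
have : (1 - c ^+ 2) ^+ 2 <= (l - c * m) ^+ 2.
  by rewrite gram expr2 ler_wpM2r ?(ltW cc)//; lra.
rewrite ler_pXn2r ?nnegrE ?(ltW cc) ?subr_ge0 ?(ltW lcm)// => h.
nra.
Qed.

(** The unit vector in the direction of [u], for the Euclidean norm. *)
Definition unitize u : 'rV[R]_2 := (Num.sqrt (dot u u))^-1 *: u.

Lemma sqrt_dot_gt0 u : u != 0 -> 0 < Num.sqrt (dot u u).
Proof.
move=> u0; rewrite sqrtr_gt0 lt_neqAle dot_ge0 andbT eq_sym.
by apply: contra u0 => /eqP/dot_eq0 ->.
Qed.

Lemma dot_unitize u : u != 0 -> dot (unitize u) (unitize u) = 1.
Proof.
move=> u0; have s0 := sqrt_dot_gt0 u0.
rewrite /unitize dotZl dotZr mulrA -expr2 exprVn sqr_sqrtr ?dot_ge0//.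
by rewrite mulVf//; apply: contra u0 => /eqP/dot_eq0 ->.
Qed.

Lemma dot_continuous (T : topologicalType) (F G : T -> 'rV[R]_2) x :
  {for x, continuous F} -> {for x, continuous G} ->
  {for x, continuous (fun t => dot (F t) (G t))}.
Proof.
move=> cF cG.
have coord (H : T -> 'rV[R]_2) i : {for x, continuous H} ->
    {for x, continuous (fun t => H t 0 i)}.
  move=> cH; apply: (@continuous_comp
    _ _ _ H (fun M : 'rV[R]_2 => M 0 i)) => //.
  exact: coord_continuous.
by apply: cvgD; apply: cvgM; apply: coord.
Qed.

Lemma unitize_continuous (T : topologicalType) (F : T -> 'rV[R]_2) x :
  {for x, continuous F} -> F x != 0 ->
  {for x, continuous (fun t => unitize (F t))}.
Proof.
move=> cF Fx0; apply: cvgZ => //.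
apply: cvgV; first by rewrite gt_eqF// sqrt_dot_gt0.
apply: (@continuous_comp _ _ _ (fun t => dot (F t) (F t)) Num.sqrt).
  exact: dot_continuous.
exact: sqrt_continuous.
Qed.

(** Let [p] and [q] be two points of [S] seen from [v] under the largest
    possible angle. If this angle is less than 180 degrees, the sum of the unit
    vectors pointing from [p] and [q] to [v] separates [v] from [S]: otherwise
    some third point of [S] would form with [p] and [q] a triangle around
    [v]. *)
Lemma compact_separation (S : set 'rV[R]_2) v :
  compact S -> ~ convex_hull S v ->
  exists f, forall s, S s -> dot f s < dot f v.
Proof.
move=> cS vS.
have S_neq s : S s -> v - s != 0.
  move=> Ss; apply/eqP => /eqP; rewrite subr_eq0 => /eqP vs.
  by apply: vS; rewrite vs; exact: sub_convex_hull.
have [S0|/set0P[s0 Ss0]] := eqVneq S set0.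
  by exists 0 => s; rewrite S0.
pose n s := unitize (v - s).
have nn s : S s -> dot (n s) (n s) = 1.
  by move=> Ss; apply: dot_unitize; exact: S_neq.
have cn s : S s -> {for s, continuous n}.
  move=> Ss; apply: unitize_continuous; last exact: S_neq.
  apply: (@continuousB _ _ _ (fun=> v) (fun t => t)).
    exact: cst_continuous.
  exact: cvg_id.
have nE s a : a *: n s = (a / Num.sqrt (dot (v - s) (v - s))) *: (v - s).
  by rewrite scalerA.
have relation s t r (a b c : R) : S s -> S t -> S r ->
    0 <= a -> 0 <= b -> 0 < c -> a *: n s + b *: n t + c *: n r = 0 -> False.
  move=> Ss St Sr a0 b0 c0; rewrite !nE => rel; apply: vS.
  have pos w : S w -> 0 < Num.sqrt (dot (v - w) (v - w)).
    by move=> Sw; apply: sqrt_dot_gt0; exact: S_neq.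
  apply: (convex_hull_relation Ss St Sr _ _ _ _ rel).
  - by rewrite divr_ge0// ltW// pos.
  - by rewrite divr_ge0// ltW// pos.
  - by rewrite divr_ge0// ltW// pos.
  - by rewrite ltr_wpDl// ?divr_gt0 ?pos// addr_ge0// divr_ge0// ltW// pos.
(* The largest angle corresponds to the least cosine. *)
have [||[p q]] := @compact_EVT_min _ R (fun st => dot (n st.1) (n st.2))
    (S `*` S) _ (compact_setX cS cS).
- by exists (s0, s0).
- apply: continuous_in_subspaceT => -[s t]; rewrite inE => -[/= Ss St].
  apply: (@dot_continuous _ (fun st => n st.1) (fun st => n st.2)).
  + by apply: continuous_comp; [exact: cvg_fst|exact: cn].
  + by apply: continuous_comp; [exact: cvg_snd|exact: cn].
rewrite inE => -[/= Sp Sq] pq_min.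
have pq_le s t : S s -> S t -> dot (n p) (n q) <= dot (n s) (n t).
  by move=> Ss St; apply: (pq_min (s, t)); rewrite inE.
exists (n p + n q) => s Ss; rewrite -subr_gt0 -dotBr.
have vsE : v - s = Num.sqrt (dot (v - s) (v - s)) *: n s.
  by rewrite nE divff ?scale1r// gt_eqF// sqrt_dot_gt0// S_neq.
rewrite vsE dotZr mulr_gt0 ?sqrt_dot_gt0 ?S_neq//.
rewrite dotDl ![dot _ (n s)]dotC.
have sp := pq_le _ _ Ss Sp; have sq := pq_le _ _ Ss Sq.
have pp := nn _ Sp; have qq := nn _ Sq; have ss := nn _ Ss.
have c_gtN1 : -1 < dot (n p) (n q).
  rewrite ltNge; apply/negP => cN1.
  apply: (relation p q q 1 0 1) => //.
  rewrite scale0r addr0 !scale1r; apply: dot_eq0.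
  apply/eqP; rewrite eq_le dot_ge0 andbT dotDl !dotDr (dotC (n q)) pp qq.
  lra.
have [c_gt0|c_le0] := ltP 0 (dot (n p) (n q)); first lra.
(* A point [s] that is not separated lies in the cone opposite to [p], [q]. *)
rewrite ltNge; apply/negP => le0.
have cc : 0 < 1 - dot (n p) (n q) ^+ 2 by nra.
apply: (relation p q s (dot (n p) (n q) * dot (n s) (n q) - dot (n s) (n p))
  (dot (n p) (n q) * dot (n s) (n p) - dot (n s) (n q)) _ Sp Sq Ss _ _ cc).
- by rewrite subr_ge0; apply: unit_coef_le0.
- rewrite subr_ge0 (dotC (n p)); apply: unit_coef_le0 => //;
    by rewrite ?(dotC (n q)) // addrC.
- rewrite dot_decomposition// -[X in X *: n p + _]opprB.
  by rewrite -[X in _ + X *: n q + _]opprB !scaleNr -opprD addNr.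
Qed.

(** * Linear forms peaking at the vertices of a triangle *)

Section Dual.
Variable A : 'I_3 -> 'rV[R]_2.

(** Among the vertices, [f] is maximal exactly at those equal to [A j]: it lies
    in the interior of the normal cone of the triangle at [A j]. *)
Definition peaks f (j : 'I_3) :=
  forall i, A i != A j -> dot f (A i) < dot f (A j).

(** The determinant of the forms [f] and [g] in the coordinates given by the
    edges [A j - A i] and [A k - A i]; it is invariant under cyclic
    permutations of [i], [j], [k]. *)
Definition turn f g (i j k : 'I_3) : R :=
  dot f (A j - A i) * dot g (A k - A i) - dot f (A k - A i) * dot g (A j - A i).

(** As there are three indices, [i], [j] and [k] are then distinct. *)
Definition labelling (i j k : 'I_3) := forall m, m = i \/ m = j \/ m = k.

(** If [f], [g], [h] peak at the vertices [i], [j], [k] and the angle from [f]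
    to [h] is less than 180 degrees, then [g] lies between [f] and [h]. *)
Lemma turn_between f g h i j k :
  dot f (A j) < dot f (A i) -> dot f (A k) < dot f (A i) ->
  dot g (A i) < dot g (A j) -> dot g (A k) < dot g (A j) ->
  dot h (A i) < dot h (A k) -> dot h (A j) < dot h (A k) ->
  0 < turn f h i j k -> 0 < turn g h i j k /\ 0 < turn f g i j k.
Proof.
rewrite /turn !dotBr.
move: (dot f (A i)) (dot f (A j)) (dot f (A k)) => fi fj fk.
move: (dot g (A i)) (dot g (A j)) (dot g (A k)) => gi gj gk.
move: (dot h (A i)) (dot h (A j)) (dot h (A k)) => hi hj hk.
move=> fji fki gij gkj hik hjk pos.
have [a a0 aE] : exists2 a, 0 < a & a = fi - fj by exists (fi - fj); lra.
have [b b0 bE] : exists2 b, 0 < b & b = fi - fk by exists (fi - fk); lra.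
set x := gj - gi; set y := gk - gi; set u := hj - hi; set v := hk - hi.
have x0 : 0 < x by rewrite /x; lra.
have yx : y < x by rewrite /x /y; lra.
have v0 : 0 < v by rewrite /v; lra.
have uv : u < v by rewrite /u /v; lra.
have av : a * v < b * u by move: pos; rewrite -/u -/v aE bE; lra.
have u0 : 0 < u by nra.
have ab : a < b by nra.
have -> : fj - fi = - a by rewrite aE; lra.
have -> : fk - fi = - b by rewrite bE; lra.
have [y0|y0] := leP y 0; split; nra.
Qed.

(** The second hypothesis says that no form of [Phi] agrees, up to a constant on
    the triangle, with a nonnegative multiple of a form of [Psi]; the multiple
    0 excludes from [Phi] the forms that are constant on the triangle. *)
Lemma dual_peaks (Phi Psi : set 'rV[R]_2) :
  (forall f g a b, 0 < a -> 0 < b -> Phi f -> Phi g -> Phi (a *: f + b *: g)) ->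
  (forall f g t, Phi f -> Psi g -> 0 <= t ->
     ~ (forall i j, dot f (A j - A i) = t * dot g (A j - A i))) ->
  (forall j, exists f, Phi f /\ peaks f j) ->
  (forall j, exists g, Psi g /\ peaks g j) -> False.
Proof.
move=> PhiD PhiPsi /choice[F FP] /choice[G GP].
have PhiF j : Phi (F j) by have [] := FP j.
have Fpeak j : peaks (F j) j by have [] := FP j.
have PsiG j : Psi (G j) by have [] := GP j.
have Gpeak j : peaks (G j) j by have [] := GP j.
have {}PhiPsi i j k f l t : labelling i j k -> Phi f -> 0 <= t ->
    dot f (A j - A i) = t * dot (G l) (A j - A i) ->
    dot f (A k - A i) = t * dot (G l) (A k - A i) -> False.
  move=> ijk fP t0 fj fk; apply: (PhiPsi f (G l) t) => // m n.
  have ft o : dot f (A o - A i) = t * dot (G l) (A o - A i).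
    by have [->|[->|->]] := ijk o => //; rewrite subrr /dot !mxE; ring.
  have -> : A n - A m = (A n - A i) - (A m - A i).
    by rewrite opprB addrA subrK.
  by rewrite (dotBr f) (dotBr (G l)) !ft; ring.
(* If all vertices coincide, every form is constant on the triangle; if only
   two of them do, a positive combination of two of the forms is. *)
have A_neq i j k : i != j -> labelling i j k -> A i != A j.
  move=> ij ijk; apply/eqP => Aij.
  have fj l : dot (F l) (A j - A i) = 0 by rewrite Aij subrr /dot !mxE; ring.
  have [Aki|Aki] := eqVneq (A k) (A i).
    apply: (PhiPsi i j k (F i) i 0 ijk) => //; rewrite mul0r ?fj//.
    by rewrite Aki subrr /dot !mxE; ring.
  have Fi := Fpeak i k Aki; have Fk := Fpeak k i.
  rewrite eq_sym in Aki; have {}Fk := Fk Aki.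
  apply: (PhiPsi i j k ((dot (F k) (A k - A i)) *: F i
      + (dot (F i) (A i - A k)) *: F k) i 0 ijk) => //.
  - by apply: PhiD => //; rewrite dotBr subr_gt0.
  - by rewrite dotDl !dotZl !fj; ring.
  - by rewrite dotDl !dotZl !dotBr; ring.
(* By Cramer's rule, [turn f h] times [g] is [turn g h] times [f] plus
   [turn f g] times [h], up to a constant on the triangle. *)
have turn_le0 i j k : labelling i j k -> i != j -> j != k -> i != k ->
    turn (F i) (F k) i j k <= 0.
  move=> ijk ij jk ik.
  have jik : labelling j i k by move=> m; have := ijk m; tauto.
  have jki : labelling j k i by move=> m; have := ijk m; tauto.
  have ikj : labelling i k j by move=> m; have := ijk m; tauto.
  have Aij := A_neq _ _ _ ij ijk; have Ajk := A_neq _ _ _ jk jki.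
  have Aik := A_neq _ _ _ ik ikj.
  have f1 := Fpeak i j; have f2 := Fpeak i k.
  have g1 := Gpeak j i; have g2 := Gpeak j k.
  have h1 := Fpeak k i; have h2 := Fpeak k j.
  rewrite eq_sym in f1; have {}f1 := f1 Aij.
  rewrite eq_sym in f2; have {}f2 := f2 Aik.
  have {}g1 := g1 Aij; rewrite eq_sym in g2; have {}g2 := g2 Ajk.
  have {}h1 := h1 Aik; have {}h2 := h2 Ajk.
  rewrite leNgt; apply/negP => pos.
  have [gh fg] : 0 < turn (G j) (F k) i j k /\ 0 < turn (F i) (G j) i j k.
    exact: turn_between.
  apply: (PhiPsi i j k (turn (G j) (F k) i j k *: F i
    + turn (F i) (G j) i j k *: F k) j (turn (F i) (F k) i j k) ijk).
  - exact: PhiD.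
  - exact: ltW.
  - by rewrite dotDl !dotZl /turn; ring.
  - by rewrite dotDl !dotZl /turn; ring.
(* Forms peaking at different vertices that are proportional have opposite
   directions, so that a positive combination of them is constant. *)
have turn_neq0 i j k : labelling i j k -> i != j ->
    turn (F i) (F j) i j k != 0.
  move=> ijk ij; apply/eqP => turn0; have Aij := A_neq _ _ _ ij ijk.
  have f1 := Fpeak i j; have f2 := Fpeak j i Aij.
  rewrite eq_sym in f1; have {}f1 := f1 Aij.
  apply: (PhiPsi i j k (dot (F j) (A j - A i) *: F i
    + dot (F i) (A i - A j) *: F j) i 0 ijk) => //.
  - by apply: PhiD => //; rewrite dotBr subr_gt0.
  - by rewrite dotDl !dotZl mul0r !dotBr; ring.
  - by rewrite mul0r -[RHS]oppr0 -[in RHS]turn0 dotDl !dotZl /turn !dotBr; ring.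
have lab : [/\ labelling 0 1 2%:R, labelling 1 2%:R 0 & labelling 2%:R 0 1].
  split=> -[[|[|[|//]]] lt3];
    by [left; exact/val_inj|right; left; exact/val_inj
       |right; right; exact/val_inj].
have [l012 l120 l201] := lab.
have pos i j k : labelling i j k -> i != j -> j != k -> i != k ->
    0 < turn (F i) (F j) i j k.
  move=> ijk ij jk ik; rewrite lt_neqAle eq_sym turn_neq0//=.
  have jki : labelling j k i by move=> m; have := ijk m; tauto.
  have turnN : turn (F j) (F i) j k i = - turn (F i) (F j) i j k.
    by rewrite /turn !dotBr; ring.
  by rewrite -oppr_le0 -turnN turn_le0// eq_sym.
have p0 := pos _ _ _ l012 isT isT isT.
have p1 := pos _ _ _ l120 isT isT isT.
have p2 := pos _ _ _ l201 isT isT isT.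
(* The three forms turn around the origin: Cramer's rule yields a positive
   combination of them that is constant on the triangle. *)
apply: (PhiPsi 0 1 2%:R (1 *: (turn (F 1) (F 2%:R) 1 2%:R 0 *: F 0
    + turn (F 2%:R) (F 0) 2%:R 0 1 *: F 1)
    + turn (F 0) (F 1) 0 1 2%:R *: F 2%:R) 0 0 l012) => //.
- by apply: (PhiD _ _ 1) => //; exact: (PhiD).
- by rewrite mul0r scale1r !dotDl !dotZl /turn !dotBr; ring.
- by rewrite mul0r scale1r !dotDl !dotZl /turn !dotBr; ring.
Qed.
End Dual.

(** * Coverings of compact sets in a triangle *)

Lemma verticesE (A : 'I_3 -> 'rV[R]_2) : [set A 0; A 1; A 2] = range A.
Proof.
apply/seteqP; split=> [x|_ [i _ <-]].
  by move=> [[]|] ->; exact: imageT.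
by case: i => [[|[|[|//]]] lt3]; [left; left|left; right|right];
  congr (A _); exact/val_inj.
Qed.

(** A form separating a point [l] of [V] peaks at [A j], because [l] lies in
    the triangle. *)
Lemma not_covered_peak (A : 'I_3 -> 'rV[R]_2) (U V : set 'rV[R]_2) j :
  compact U -> V `<=` convex_hull (range A) ->
  ~ V `<=` convex_hull (U `|` (range A `\ A j)) ->
  exists f,
    (exists2 l, V l & forall k, U k -> dot f k < dot f l) /\ peaks A f j.
Proof.
move=> cU VA nsub.
have [l [Vl nl]] : exists l, V l /\ ~ convex_hull (U `|` (range A `\ A j)) l.
  apply/not_existsP => h; apply: nsub => l Vl.
  by apply: contrapT => nl; apply: (h l).
have cS : compact (U `|` (range A `\ A j)).
  apply: compactU => //; apply: finite_compact.
  by apply: finite_setD; exact: finite_image.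
have [f fl] := compact_separation cS nl.
exists f; split; first by exists l => // k Uk; apply: fl; left.
have other i : A i != A j -> dot f (A i) < dot f l.
  by move=> /eqP Aij; apply: fl; right; split; [exists i|].
move=> i Aij; apply: (lt_le_trans (other i Aij)).
rewrite leNgt; apply/negP => fj.
have : dot f l < dot f l.
  apply: (convex_hull_dot_lt _ (VA _ Vl)) => _ [m _ <-].
  by have [->//|] := eqVneq (A m) (A j); exact: other.
by rewrite ltxx.
Qed.

(** One of [U] and [V] is in the convex hull of the other one and of the
    vertices of the triangle [A] different from some vertex. *)
Definition covered (A : 'I_3 -> 'rV[R]_2) (U V : set 'rV[R]_2) :=
  exists j, V `<=` convex_hull (U `|` (range A `\ A j)) \/
            U `<=` convex_hull (V `|` (range A `\ A j)).

Lemma coveredC (A : 'I_3 -> 'rV[R]_2) (U V : set 'rV[R]_2) :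
  covered A U V -> covered A V U.
Proof. by move=> [j cov]; exists j; tauto. Qed.

(** The concavity of [phi(f) = h_V(f) - h_U(f)] enters through a set [D] of
    vectors: every form with [phi(f) > 0] is positive on [D], the forms
    positive on [D] are a convex cone, and such a form exceeds on [V] each of
    its values on [U]. *)
Lemma covered_of_concave (A : 'I_3 -> 'rV[R]_2) (U V D : set 'rV[R]_2) :
  compact U -> compact V ->
  U `<=` convex_hull (range A) -> V `<=` convex_hull (range A) ->
  (forall f l, V l -> (forall k, U k -> dot f k < dot f l) ->
     forall w, D w -> 0 < dot f w) ->
  (forall f k, U k -> (forall w, D w -> 0 < dot f w) ->
     exists2 l, V l & dot f k < dot f l) ->
  covered A U V.
Proof.
move=> cU cV UA VA VD DV; apply: contrapT => /forallNP ncov.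
apply: (dual_peaks (A := A) (Phi := [set f | forall w, D w -> 0 < dot f w])
  (Psi := [set g | exists2 k, U k & forall l, V l -> dot g l < dot g k])).
- move=> f g a b a0 b0 fD gD w Dw; rewrite dotDl !dotZl.
  by rewrite addr_gt0// mulr_gt0//; [exact: fD|exact: gD].
- move=> f g t fD [k Uk gk] t0 fg.
  have [l Vl fkl] := DV f k Uk fD; have glk := gk _ Vl.
  have const x : convex_hull (range A) x ->
      dot (f - t *: g) x = dot (f - t *: g) (A 0).
    apply: convex_hull_dot_eq => _ [i _ <-]; apply/eqP; rewrite -subr_eq0.
    rewrite -dotBr -scaleNr dotDl dotZl fg; apply/eqP; ring.
  have := const _ (VA _ Vl); rewrite -(const _ (UA _ Uk)).
  rewrite -scaleNr !dotDl !dotZl => E.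
  have : 0 <= t * (dot g k - dot g l) by rewrite mulr_ge0// subr_ge0 ltW.
  lra.
- move=> j; have [f [[l Vl fl] fj]] : exists f,
      (exists2 l, V l & forall k, U k -> dot f k < dot f l) /\ peaks A f j.
    by apply: not_covered_peak => // VU; apply: (ncov j); left.
  by exists f; split=> //; exact: VD Vl fl.
- by move=> j; apply: not_covered_peak => // UV; apply: (ncov j); right.
Qed.

Lemma covered_contraction (A : 'I_3 -> 'rV[R]_2) (U V : set 'rV[R]_2) P lambda :
  compact U -> compact V ->
  U `<=` convex_hull (range A) -> V `<=` convex_hull (range A) ->
  0 <= lambda < 1 -> V = homothety P lambda @` U ->
  covered A U V.
Proof.
move=> cU cV UA VA /andP[l0 l1] VE.
apply: (covered_of_concave (D := [set P - k | k in U])) => //.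
- rewrite VE => f _ [m Um <-] fU _ [k Uk <-].
  have := fU _ Uk; have := fU _ Um.
  rewrite /homothety dotBr dotDr !dotZr => fm fk.
  have : 0 < (1 - lambda) * (dot f P - dot f m) by lra.
  rewrite pmulr_rgt0 ?subr_gt0// => mP.
  have : 0 <= lambda * (dot f P - dot f m) by rewrite mulr_ge0// subr_ge0 ltW.
  lra.
- move=> f k Uk fD; exists (homothety P lambda k).
    by rewrite VE; exists k.
  have : 0 < (1 - lambda) * dot f (P - k).
    by rewrite mulr_gt0 ?subr_gt0//; apply: fD; exists k.
  by rewrite /homothety dotBr dotDr !dotZr; lra.
Qed.

Lemma covered_translation (A : 'I_3 -> 'rV[R]_2) (U V : set 'rV[R]_2) Q :
  compact U -> compact V ->
  U `<=` convex_hull (range A) -> V `<=` convex_hull (range A) ->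
  V = translation Q @` U ->
  covered A U V.
Proof.
move=> cU cV UA VA VE; apply: (covered_of_concave (D := [set Q])) => //.
- rewrite VE => f _ [m Um <-] fU _ ->.
  by have := fU _ Um; rewrite /translation dotDr ltrDr.
- move=> f k Uk fD; exists (translation Q k); first by rewrite VE; exists k.
  by rewrite /translation dotDr ltrDr fD.
Qed.

Lemma covered_singleton (A : 'I_3 -> 'rV[R]_2) (U V : set 'rV[R]_2) X :
  compact U -> compact V ->
  U `<=` convex_hull (range A) -> V `<=` convex_hull (range A) ->
  V = [set X] ->
  covered A U V.
Proof.
move=> cU cV UA VA VE.
apply: (covered_of_concave (D := [set X - k | k in U])) => //.
- by rewrite VE => f _ -> fU _ [k Uk <-]; rewrite dotBr subr_gt0 fU.
- move=> f k Uk fD; exists X; first by rewrite VE.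
  by rewrite -subr_gt0 -dotBr; apply: fD; exists k.
Qed.

Lemma covered_homothety (A : 'I_3 -> 'rV[R]_2) (U V : set 'rV[R]_2) P lambda :
  compact U -> compact V ->
  U `<=` convex_hull (range A) -> V `<=` convex_hull (range A) ->
  0 < lambda -> V = homothety P lambda @` U ->
  covered A U V.
Proof.
move=> cU cV UA VA l0 VE; have [l1|l1|l1] := ltgtP lambda 1.
- by apply: (covered_contraction cU cV UA VA _ VE); rewrite ltW.
- have lV : 0 <= lambda^-1 < 1 by rewrite invr_ge0 ltW//= invf_lt1.
  have UE : U = homothety P lambda^-1 @` V.
    have inv x : homothety P lambda^-1 (homothety P lambda x) = x.
      apply: row2P; rewrite /homothety !mxE; field; exact: lt0r_neq0.
    rewrite VE image_comp; apply/seteqP; split=> [x Ux|_ [x Ux <-]].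
      by exists x => //=.
    by rewrite /= inv.
  by apply: coveredC; exact: covered_contraction cV cU VA UA lV UE.
- apply: (covered_translation (Q := 0)) => //.
  rewrite VE; apply: eq_imagel => x _.
  by rewrite /homothety /translation l1 subrr scale0r scale1r.
Qed.

End Plane.

Theorem theorem1p1 (R : realType) (A : 'I_3 -> 'rV[R]_2)
  (U : 'I_2 -> set 'rV[R]_2)
  (compact_U0 : compact (U 0)) (compact_U1 : compact (U 1))
  (U_abc :
    [\/ exists (P : 'rV[R]_2) (lambda : R),
          0 < lambda /\ U 1 = homothety P lambda @` U 0,
        exists Q : 'rV[R]_2, U 1 = translation Q @` U 0
      | (exists X : 'rV[R]_2, U 0 = [set X]) \/
        (exists X : 'rV[R]_2, U 1 = [set X])])
  (sub_U : U 0 `|` U 1 `<=` convex_hull [set A 0; A 1; A 2]) :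
  exists (j : 'I_3) (k : 'I_2),
    U (1 - k) `<=` convex_hull (U k `|` ([set A 0; A 1; A 2] `\ A j)).
Proof.
rewrite verticesE in sub_U *.
have UA : U 0 `<=` convex_hull (range A) by move=> x Ux; apply: sub_U; left.
have VA : U 1 `<=` convex_hull (range A) by move=> x Ux; apply: sub_U; right.
suff [j [cov|cov]] : covered A (U 0) (U 1).
- by exists j, 0; rewrite subr0.
- by exists j, 1; rewrite subrr.
case: U_abc => [[P [lambda [lambda_gt0 UE]]]|[Q UE]|[[X UE]|[X UE]]].
- exact: covered_homothety lambda_gt0 UE.
- exact: covered_translation UE.
- by apply: coveredC; exact: covered_singleton compact_U1 compact_U0 VA UA UE.
- exact: covered_singleton UE.
Qed.
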